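(* Let $a=\{a_n\}_{n\ge 1}$ be a sequence of real or complex numbers, and let $r=\{r_n\}_{n\ge1}$ and $s=\{s_n\}_{n\ge1}$ be bounded sequences of strictly positive real numbers. The Rhaly operator $R_a : c_0(r)\to c_0(s)$ is compact if and only if $$\left\{ s_n a_n \sum_{k=1}^{n}\frac{1}{r_k}\right\}_{n\in\mathbb{N}} \in c_0.$$
   Context: $\mathbb{N}=\{1,2,\dots\}$; $c_0$ is the space of complex sequences converging to $0$. For a sequence $r=\{r_n\}$ of strictly positive reals, $c_0(r)=\{\{x_k\}\in\mathbb{C}^{\mathbb{N}}:\lim_{k\to\infty} r_kx_k=0\}$, a Banach space with norm $\|x\|_r=\sup_k |x_k|r_k$. The Rhaly operator $R_a$ is given by the lower triangular terraced matrix whose $n$-th row is $(a_n,\dots,a_n,0,0,\dots)$ with $n$ entries equal to $a_n$, i.e. $(R_ax)_n=a_n\sum_{k=1}^n x_k$. ''$R_a:c_0(r)\to c_0(s)$ is compact'' means that $R_a$ maps $c_0(r)$ into $c_0(s)$ as a compact linear operator. *)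

(* Defs.v *)
From HB Require Import structures.
From mathcomp Require Import all_boot all_order all_algebra.
From mathcomp Require Import all_classical all_reals all_analysis.
From mathcomp Require Import complex.

Set Implicit Arguments.
Unset Strict Implicit.
Unset Printing Implicit Defensive.

Import Order.TTheory GRing.Theory Num.Theory.
Import numFieldNormedType.Exports.
Import Normc.

Local Open Scope classical_set_scope.
Local Open Scope ring_scope.
Local Open Scope complex_scope.

(* R[i] is the field of complex numbers over R; R[i]^o is the same type seen as a
   normed space over itself, which is how it gets its topology. *)

(* Sequences are indexed by nat: x n stands for the term x_{n+1} of a sequence
   indexed by 1, 2, 3, and so on. *)
Definition c0 (R : realType) : set (nat -> R[i]^o) :=
  [set x | x @ \oo --> (0 : R[i]^o)].

Section weighted_c0.
Variables (R : realType) (r : nat -> {posnum R}).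

Definition weighted (x : nat -> R[i]^o) : nat -> R[i]^o :=
  fun k => ((r k)%:num)%:C * x k.

Definition c0w_pred : {pred (nat -> R[i]^o)} :=
  [pred x | `[< c0 (weighted x) >]].

Lemma c0w_predP (x : nat -> R[i]^o) : reflect (c0 (weighted x)) (x \in c0w_pred).
Proof. by rewrite inE; exact: asboolP. Qed.

Lemma c0w_submod_closed : submod_closed c0w_pred.
Proof.
split=> [|c x y /c0w_predP xr /c0w_predP yr]; apply/c0w_predP.
  rewrite /c0 /= (_ : weighted 0 = fun=> 0); first exact: cvg_cst.
  by apply/funext => k; rewrite /weighted mulr0.
rewrite /c0 /= (_ : weighted _ = (fun k => c * weighted x k + weighted y k)).
  rewrite (_ : 0 = c * 0 + 0 :> R[i]^o); last by rewrite mulr0 addr0.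
  exact: (cvgD (cvgM (cvg_cst (c : R[i]^o)) xr) yr).
by apply/funext => k; rewrite /weighted /= mulrDr mulrCA.
Qed.

HB.instance Definition _ :=
  GRing.isSubmodClosed.Build R[i] (nat -> R[i]^o) c0w_pred c0w_submod_closed.

(* The space c_0(r). *)
Record c0w := C0w { c0w_val :> nat -> R[i]^o; _ : c0w_val \in c0w_pred }.

HB.instance Definition _ := [isSub for c0w_val].
HB.instance Definition _ := [Choice of c0w by <:].
HB.instance Definition _ := [SubChoice_isSubLmodule of c0w by <:].

(* The moduli |x_k| r_k; normc is the R-valued modulus. *)
Definition c0w_moduli (x : c0w) : set R :=
  range (fun k => normc (x k) * (r k)%:num).

(* In a normed module over R[i], the norm takes its (real) values in R[i]. *)
Definition c0w_norm (x : c0w) : R[i] := (sup (c0w_moduli x))%:C.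

Lemma c0w_moduli0 (x : c0w) : c0w_moduli x !=set0.
Proof. by exists (normc (x 0%N) * (r 0%N)%:num); exists 0%N. Qed.

Lemma normC_weighted (x : c0w) k :
  `|weighted x k| = (normc (x k) * (r k)%:num)%:C :> R[i]^o.
Proof.
rewrite /weighted normrM mulrC rmorphM; congr (_ * _).
by rewrite ger0_norm// lecR.
Qed.

Lemma c0w_moduli_ubound (x : c0w) : has_ubound (c0w_moduli x).
Proof.
have /c0w_predP xr : (x : nat -> R[i]^o) \in c0w_pred by case: x.
have wcv : cvgn (weighted x) by apply/cvg_ex; exists (0 : R[i]^o).
have [M [_ xM]] := cvg_seq_bounded wcv.
exists (complex.Re (M + 1)) => _ [k _ <-].
by have := xM (M + 1) (ltr_pwDr ltr01 (lexx M)) k I; rewrite /= normC_weighted lecE /= => /andP[].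
Qed.

Lemma c0w_moduli_le (x : c0w) k :
  normc (x k) * (r k)%:num <= sup (c0w_moduli x).
Proof. by apply: ub_le_sup; [exact: c0w_moduli_ubound|exists k]. Qed.

Lemma sup_moduli_ge0 (x : c0w) : 0 <= sup (c0w_moduli x).
Proof.
apply: le_trans (c0w_moduli_le x 0); rewrite mulr_ge0//.
by have := normr_ge0 (x 0%N : R[i]); rewrite lecR.
Qed.

Lemma c0w_ler_normD (x y : c0w) : c0w_norm (x + y) <= c0w_norm x + c0w_norm y.
Proof.
rewrite /c0w_norm -rmorphD lecR; apply: ge_sup; first exact: c0w_moduli0.
move=> _ [k _ <-]; apply: le_trans (lerD (c0w_moduli_le x k) (c0w_moduli_le y k)).
by rewrite -mulrDl ler_wpM2r// le_normcD.
Qed.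

Lemma c0w_norm_scale_le (c : R[i]^o) (x : c0w) :
  c0w_norm (c *: x) <= `|c| * c0w_norm x.
Proof.
rewrite /c0w_norm -rmorphM lecR; apply: ge_sup; first exact: c0w_moduli0.
move=> _ [k _ <-]; rewrite [_ k](_ : _ = c * x k)// normcM -mulrA.
rewrite ler_wpM2l ?c0w_moduli_le//.
by have := normr_ge0 (c : R[i]); rewrite lecR.
Qed.

Lemma c0w_normrZ (c : R[i]^o) (x : c0w) : c0w_norm (c *: x) = `|c| * c0w_norm x.
Proof.
apply/eqP; rewrite eq_le c0w_norm_scale_le/=.
have [->|c0] := eqVneq c 0.
  by rewrite normr0 mul0r /c0w_norm lecR sup_moduli_ge0.
rewrite -ler_pdivlMl ?normr_gt0// -normfV.
by rewrite -{1}[x](scalerK c0) c0w_norm_scale_le.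
Qed.

Lemma c0w_normr0_eq0 (x : c0w) : c0w_norm x = 0 -> x = 0.
Proof.
move=> [x0]; apply/val_inj/funext => k /=.
apply: eq0_normc; apply/eqP; rewrite eq_le.
have -> : 0 <= normc (x k) by have := normr_ge0 (x k : R[i]); rewrite lecR.
by have := c0w_moduli_le x k; rewrite x0 pmulr_lle0// andbT.
Qed.

HB.instance Definition _ := @Lmodule_isNormed.Build R[i] c0w
  c0w_norm c0w_ler_normD c0w_normrZ c0w_normr0_eq0.

End weighted_c0.

Definition compact_operator (K : numFieldType) (V W : normedModType K)
    (T : {linear V -> W}) : Prop :=
  forall B : set V, bounded_set B -> precompact (T @` B).

(* The sum runs over the n + 1 indices 0, ..., n. *)
Definition rhaly (R : realType) (a x : nat -> R[i]^o) : nat -> R[i]^o :=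
  fun n => a n * \sum_(k < n.+1) x k.

Definition rhaly_compact (R : realType) (a : nat -> R[i]^o)
    (r s : nat -> {posnum R}) : Prop :=
  exists T : {linear c0w r -> c0w s},
    (forall x : c0w r, T x = rhaly a x :> (nat -> R[i]^o)) /\ compact_operator T.

(* Main.v *)
(* Write b_n = s_n a_n (1/r_1 + ... + 1/r_n).  Since |x_k| <= ||x|| / r_k, one
   has s_n |(R_a x)_n| <= ||x|| |b_n|, with equality for the unit vector
   x = (1/r_1, ..., 1/r_n, 0, ...).
   If b tends to 0, then R_a maps a ball into a set of the form
   {y | s_n |y_n| <= M |b_n| for all n}, which is compact.  Conversely, the
   coordinates of the elements of a compact subset of c_0(s) tend to 0
   uniformly; applied to the images of the vectors above, this gives b_n -> 0. *)
From HB Require Import structures.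
Require Import Defs.
From mathcomp Require Import all_boot all_order all_algebra.
From mathcomp Require Import all_classical all_reals all_analysis.
From mathcomp Require Import complex.
Import Order.TTheory GRing.Theory Num.Theory.
Import numFieldNormedType.Exports.
Local Open Scope classical_set_scope.
Local Open Scope ring_scope.
Local Open Scope complex_scope.

(** The image of an ultrafilter is again an ultrafilter, because [G] contains the preimage of each
    set or of its complement; compactness then supplies the limit. *)
Lemma ultra_fmap_cvg (T : Type) (U : topologicalType) (G : set_system T)
    (f : T -> U) (K : set U) :
  UltraFilter G -> compact K -> (f @ G) K -> exists2 z, K z & f @ G --> z.
Proof.
move=> GU Kc GK.
have fGU : UltraFilter (f @ G).
  split=> [|H HF GH]; first exact: fmap_proper_filter.
  rewrite predeqE => A; split=> [HA|]; last exact: GH.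
  have [//|GnA] := in_ultra_setVsetC (f @^-1` A) GU.
  have HnA : H (~` A) by apply: GH.
  by have [x [Ax nAx]] := filter_ex (filterI HA HnA).
by move: Kc; rewrite compact_ultra => /(_ _ fGU GK)[z [Kz fz]]; exists z.
Qed.

Lemma real_complex_continuous (R : realType) :
  continuous (fun t : R => t%:C : R[i]^o).
Proof.
move=> t; apply/cvgrPdist_lt => e e0.
(* A positive element of [R[i]] is real, so the radius comes from [R], where the embedding is an
   isometry. *)
have /complex_realP[d de] : e \is Num.real by exact: gtr0_real.
move: e0; rewrite de ltcR => d0.
have : \forall u \near t, `|t - u| < d.
  by have /cvgrPdist_lt/(_ _ d0) : id @ t --> t := cvg_id.
apply: filterS => u tu.
by rewrite -rmorphB normc_def /= expr0n addr0 sqrtr_sqr ltcR.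
Qed.

(** The order of [K] may be partial; [M] being real turns the failure of the bound at [z] into
    [M < |z|], and the ball of radius [|z| - M] around [z] then misses the set. *)
Lemma closed_norm_le (K : numFieldType) (V : normedModType K) (M : K) :
  M \is Num.real -> closed [set z : V | `|z| <= M].
Proof.
move=> Mr z clz; apply: contrapT => /negP; rewrite -real_ltNge// => Mz.
have /cvgrPdist_lt/(_ (`|z| - M)) : id @ z --> z := cvg_id.
rewrite subr_gt0 => /(_ Mz)/clz[y [/= yM]]; rewrite ltrBrDr => yz.
suff : `|z| < `|z| by rewrite ltxx.
apply: le_lt_trans yz; rewrite -{1}(subrK y z).
by rewrite (le_trans (ler_normD _ _))// lerD2l.
Qed.

(** The disc is closed and lies in the continuous image [h] of a compact square of [R * R]. *)
Lemma compact_complex_ball (R : realType) (M : R) :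
  compact [set z : R[i]^o | `|z| <= M%:C].
Proof.
pose h (p : R * R) : R[i]^o := (p.1)%:C + 'i%C * (p.2)%:C.
have hc : continuous h.
  move=> p; apply: cvgD; last apply: cvgM.
  - apply: (@continuous_comp _ _ _ fst (fun t : R => t%:C : R[i]^o)).
      exact: cvg_fst.
    exact: real_complex_continuous.
  - exact: cvg_cst.
  - apply: (@continuous_comp _ _ _ snd (fun t : R => t%:C : R[i]^o)).
      exact: cvg_snd.
    exact: real_complex_continuous.
have sqc : compact (h @` (`[- M, M] `*` `[- M, M])).
  apply: continuous_compact; first exact: continuous_subspaceT.
  by apply: compact_setX; exact: segment_compact.
apply: subclosed_compact sqc _.
- by apply: closed_norm_le; apply/complex_realP; exists M.
- move=> z /= zM; exists (complex.Re z, complex.Im z); last first.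
    by rewrite /h /= -complexE.
  have ReM : `|complex.Re z| <= M.
    by rewrite -lecR (le_trans _ zM)// normc_ge_Re.
  have ImM : `|complex.Im z| <= M.
    (* Multiplying by ['i] keeps the modulus and makes the imaginary part, up to sign, a real
       part. *)
    have := normc_ge_Re (z * 'i%C); rewrite ReiNIm normrN normrM.
    rewrite (_ : `|'i%C| = 1 :> R[i]) ?mulr1; last first.
      by rewrite normc_def /= expr0n add0r expr1n sqrtr1.
    by rewrite -lecR => /le_trans; apply.
  by split; rewrite /= in_itv /= -ler_norml.
Qed.

Section weighted_c0_theory.
Context {R : realType} (r : nat -> {posnum R}).
Implicit Types x y : c0w r.

Lemma weightedB x y k :
  weighted r (x - y : c0w r) k = weighted r x k - weighted r y k.
Proof. by rewrite /weighted -mulrBr. Qed.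

Lemma weighted_cvg x : weighted r x @ \oo --> (0 : R[i]^o).
Proof. by apply/c0w_predP; case: x. Qed.

Lemma le_weighted_norm x k : `|weighted r x k| <= `|x|.
Proof. by rewrite normC_weighted lecR c0w_moduli_le. Qed.

Lemma c0w_norm_le x (M : R) :
  (forall k, `|weighted r x k| <= M%:C) -> `|x| <= M%:C.
Proof.
move=> xM; rewrite lecR; apply: ge_sup; first exact: c0w_moduli0.
by move=> _ [k _ <-]; rewrite -lecR -normC_weighted.
Qed.

End weighted_c0_theory.

Section dominated.
Context {R : realType} (s : nat -> {posnum R}).

Lemma dominated_cvg0 (u c : nat -> R[i]^o) :
  (forall k, `|u k| <= `|c k|) -> c @ \oo --> (0 : R[i]^o) ->
  u @ \oo --> (0 : R[i]^o).
Proof.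
move=> uc /cvgr0Pnorm_lt c0; apply/cvgr0Pnorm_lt => e /c0.
by apply: filterS => k; exact: le_lt_trans.
Qed.

Definition unweighted (z : nat -> R[i]^o) : nat -> R[i]^o :=
  fun k => ((s k)%:num^-1)%:C * z k.

Lemma unweightedK z : weighted s (unweighted z) = z.
Proof.
apply/funext => k.
by rewrite /weighted /unweighted mulrA -rmorphM divff ?mul1r.
Qed.

Lemma unweighted_c0w z : z @ \oo --> (0 : R[i]^o) ->
  unweighted z \in c0w_pred s.
Proof. by move=> z0; apply/c0w_predP; rewrite /c0 /= unweightedK. Qed.

(* An ultrafilter on the set converges coordinatewise, and the coordinates
   beyond a large index contribute uniformly little to the norm. *)
Lemma compact_dominated (c : nat -> R[i]^o) : c @ \oo --> (0 : R[i]^o) ->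
  compact [set y : c0w s | forall k, `|weighted s y k| <= `|c k|].
Proof.
move=> c0; rewrite compact_ultra => G GU GK.
have /choice[z zP] k : exists z : R[i]^o, `|z| <= `|c k| /\
    (fun y : c0w s => weighted s y k) @ G --> z.
  have /complex_realP[M cM] : `|c k| \is Num.real by exact: normr_real.
  have [|z /= zM Gz] := @ultra_fmap_cvg _ _ G (fun y : c0w s => weighted s y k)
    _ GU (compact_complex_ball R M).
    suff : G [set y | `|weighted s y k| <= `|c k|] by rewrite cM.
    by apply: filterS GK => y; exact.
  by exists z; rewrite cM.
have z0 : z @ \oo --> (0 : R[i]^o).
  by apply: dominated_cvg0 c0 => k; have [] := zP k.
pose y : c0w s := C0w (unweighted_c0w z z0).
have wy k : weighted s y k = z k by rewrite unweightedK.
exists y; split=> [k|]; first by rewrite wy; have [] := zP k.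
apply/cvgrPdist_le => e e0.
have /complex_realP[d de] : e \is Num.real by exact: gtr0_real.
have e20 : 0 < e / 2 by rewrite divr_gt0.
have /cvgr0Pnorm_lt/(_ _ e20)[N _ cN] := c0.
(* Finitely many indices lie below [N], so one set of [G] serves them all. *)
have Gz : G [set t : c0w s | forall k : 'I_N, `|z k - weighted s t k| <= e].
  apply: filter_forall => k.
  by have [_ /cvgrPdist_le/(_ _ e0)] := zP k.
apply: filterS2 GK Gz => t tc tz; rewrite de; apply: c0w_norm_le => k.
rewrite -de weightedB wy; have [kN|Nk] := ltnP k N.
  exact: (tz (Ordinal kN)).
apply: le_trans (ler_normB _ _) _; rewrite (splitr e) lerD//.
  by have [zk _] := zP k; exact: le_trans zk (ltW (cN _ Nk)).
exact: le_trans (tc k) (ltW (cN _ Nk)).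
Qed.

(** Near each [y], elements within [e / 2] of [y] have coordinates below [e] once those of [y] are
    below [e / 2]. Compactness, as near-covering, makes the index threshold uniform over [K]. *)
Lemma compact_tails (K : set (c0w s)) (e : R[i]) : compact K -> 0 < e ->
  \forall n \near \oo, forall y, K y -> `|weighted s y n| < e.
Proof.
move=> + e0; rewrite compact_near_coveringP.
move=> /(_ nat \oo (fun n y => `|weighted s y n| < e) _); apply.
move=> y _; have e20 : 0 < e / 2 by rewrite divr_gt0.
have /cvgrPdist_lt/(_ _ e20) yn : id @ y --> y := cvg_id.
have /cvgr0Pnorm_lt/(_ _ e20) yo := weighted_cvg s y.
near=> x n.
rewrite -[weighted s x n](subrK (weighted s y n)).
apply: le_lt_trans (ler_normD _ _) _; rewrite (splitr e) ltrD//; last first.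
  by near: n.
rewrite -weightedB; apply: le_lt_trans (le_weighted_norm s _ _) _.
by rewrite distrC; near: x.
Unshelve. all: by end_near. Qed.

End dominated.

Section rhaly.
Context {R : realType} (a : nat -> R[i]^o) (r s : nat -> {posnum R}).

Let b (n : nat) : R[i]^o :=
  ((s n)%:num)%:C * a n * \sum_(k < n.+1) (((r k)%:num)^-1)%:C.

(** The right-hand side is kept as the modulus of a sequence term, the form of domination used in
    [dominated_cvg0] and [compact_dominated]. *)
Lemma le_weighted_rhaly (x : c0w r) n :
  `|weighted s (rhaly a x) n| <= `| `|x| * b n|.
Proof.
rewrite /weighted /rhaly /b mulrA [leLHS]normrM [leRHS]normrM normr_id.
rewrite [`|_ * \sum_(_ < _) _|]normrM [leRHS]mulrCA ler_wpM2l//.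
rewrite [X in _ * X]ger0_norm; last by apply: sumr_ge0 => k _; rewrite ler0c.
rewrite mulr_sumr; apply: le_trans (ler_norm_sum _ _ _) _.
apply: ler_sum => k _; rewrite (_ : x k = ((r k)%:num^-1)%:C * weighted r x k).
  rewrite normrM mulrC ler_pM// ?(le_weighted_norm r)// ger0_norm// ler0c//.
by rewrite /weighted mulrA -rmorphM mulVf ?mul1r.
Qed.

Lemma rhaly_subproof (b0 : c0 b) (x : c0w r) : rhaly a x \in c0w_pred s.
Proof.
apply/c0w_predP; apply: dominated_cvg0 (le_weighted_rhaly x) _.
rewrite -[0](mulr0 `|x|); apply: cvgM; [exact: cvg_cst|exact: b0].
Qed.

(** The proof [b0] is an argument because it is what places the image in [c0w s]. *)
Definition rhaly_op (b0 : c0 b) (x : c0w r) : c0w s :=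
  C0w (rhaly_subproof b0 x).

Lemma rhaly_op_is_linear (b0 : c0 b) : linear (rhaly_op b0).
Proof.
move=> c x y; apply/val_inj/funext => n /=.
rewrite /rhaly [RHS](_ : _ =
  c * (a n * \sum_(k < n.+1) x k) + a n * \sum_(k < n.+1) y k)//.
by rewrite mulrCA -mulrDr; congr (_ * _); rewrite mulr_sumr -big_split.
Qed.

HB.instance Definition _ (b0 : c0 b) :=
  GRing.isLinear.Build R[i] (c0w r) (c0w s) *:%R
    (rhaly_op b0) (rhaly_op_is_linear b0).

Lemma compact_rhaly_op (b0 : c0 b) : compact_operator (rhaly_op b0).
Proof.
move=> B /pinfty_ex_gt0[M M0 BM].
pose K := [set y : c0w s | forall k, `|weighted s y k| <= `|M * b k|].
have Kc : compact K.
  apply: compact_dominated; rewrite -[0](mulr0 M).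
  by apply: cvgM; [exact: cvg_cst|exact: b0].
exists K; last first.
  by split=> //; apply: compact_closed => //; exact: norm_hausdorff.
move=> _ [x Bx <-] k; apply: le_trans (le_weighted_rhaly x k) _.
rewrite !normrM ler_wpM2r// normr_id (ger0_norm (ltW M0)).
exact: BM.
Qed.

Lemma rhaly_compact_cvg0 : rhaly_compact a r s -> c0 b.
Proof.
move=> [T [Ta Tc]].
(* The weighted coordinates of [u n] are 1 up to index [n] and 0 beyond, so these vectors all lie in
   the unit ball. *)
pose u n : nat -> R[i]^o :=
    fun k => if (k <= n)%N then (((r k)%:num)^-1)%:C else 0.
have wu n k : weighted r (u n) k = (k <= n)%N%:R.
  rewrite /weighted /u; case: ifP => _; last by rewrite mulr0.
  by rewrite -rmorphM divff.
have ur n : u n \in c0w_pred r.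
  apply/c0w_predP; apply/cvgr0Pnorm_lt => e e0; exists n.+1 => // k /= nk.
  by rewrite wu leqNgt nk normr0.
pose x n : c0w r := C0w (ur n).
have [|K TK [Kc _]] := Tc (range x).
  exists 1; split=> // M M1 _ [n _ <-]; apply: le_trans (ltW M1).
  apply: (c0w_norm_le r (x n) 1) => k.
  by rewrite wu; case: leq; rewrite ?normr1 ?normr0.
apply/cvgr0Pnorm_lt => e e0; apply: filterS (compact_tails s _ e Kc e0).
(* Coordinate [n] of [T (x n)] sums only indices [k <= n], where [u n] is not truncated; its
   weighted value is exactly [b n]. *)
move=> n /(_ (T (x n))); rewrite /weighted Ta /rhaly /b mulrA.
under eq_bigr => k _ do rewrite /= /u -ltnS ltn_ord.
by apply; apply: TK; exists (x n) => //; exists n.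
Qed.

End rhaly.

Theorem theorem3p2 (R : realType) (a : nat -> R[i]^o)
    (r s : nat -> {posnum R})
    (r_bounded : bounded_fun (fun n => (r n)%:num : R))
    (s_bounded : bounded_fun (fun n => (s n)%:num : R)) :
  rhaly_compact a r s <->
  c0 (fun n => ((s n)%:num)%:C * a n * \sum_(k < n.+1) (((r k)%:num)^-1)%:C).
Proof.
split=> [|b0]; first exact: rhaly_compact_cvg0.
by exists (rhaly_op a r s b0); split=> //; exact: compact_rhaly_op.
Qed.
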